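(* Let $(X,d)$ be a compact metric space and let $(X,f_{1,\infty})$ be the non-autonomous system generated by a finite family $\mathbb{F}=\{f_1,f_2,\ldots,f_k\}$ of continuous self-maps of $X$. If the autonomous system $(X,f_k\circ f_{k-1}\circ\cdots\circ f_1)$ is topologically ergodic, then $(X,f_{1,\infty})$ is also topologically ergodic.
   Context: A non-autonomous discrete dynamical system $(X,f_{1,\infty})$ consists of a compact metric space $(X,d)$ and a sequence $f_{1,\infty}=(f_n)_{n=1}^\infty$ of continuous maps $f_n:X\to X$. The system generated by a finite family $\{f_1,\ldots,f_k\}$ is the one whose sequence repeats $f_1,\ldots,f_k$ periodically, i.e. $f_{n+k}=f_n$ for all $n\ge 1$. An autonomous system $(X,g)$ is the case where all maps of the sequence equal $g$. For a sequence $g_{1,\infty}=(g_n)_{n=1}^\infty$ of continuous self-maps of $X$ and open sets $U,V\subseteq X$, put $g_1^n=g_n\circ\cdots\circ g_1$ and $N_{g_{1,\infty}}(U,V)=\{n\in\mathbb{N}: g_1^n(U)\cap V\neq\emptyset\}$. The upper density of $N_{g_{1,\infty}}(U,V)$ is $\limsup_{n\to\infty}\frac{|N_{g_{1,\infty}}(U,V)\cap\{0,1,\ldots,n-1\}|}{n}$. The system $(X,g_{1,\infty})$ is topologically ergodic if for any two non-empty open sets $U,V\subseteq X$, $N_{g_{1,\infty}}(U,V)$ has positive upper density. *)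

(* Defs.v *)
From mathcomp Require Import all_boot all_order all_algebra finmap.
From mathcomp Require Import all_classical all_reals all_analysis.

Set Implicit Arguments.
Unset Strict Implicit.
Unset Printing Implicit Defensive.

Import Order.TTheory GRing.Theory Num.Theory.
Local Open Scope classical_set_scope.
Local Open Scope ring_scope.

(* Sequences of maps g_1, g_2, ... are functions [g : nat -> X -> X] indexed
   from 1; the value [g 0] is never used.
   [iter_seq g n] is g_1^n = g_n \o ... \o g_1, and the identity for n = 0. *)
Fixpoint iter_seq (X : Type) (g : nat -> X -> X) (n : nat) : X -> X :=
  if n is m.+1 then g m.+1 \o iter_seq g m else id.

Definition hitting_times (X : Type) (g : nat -> X -> X) (U V : set X) :
    set nat :=
  [set n | (iter_seq g n @` U) `&` V !=set0].

(* [`I_n] is {0, ..., n-1}. The quotient at n = 0 is 0 / 0 = 0, which does not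
   affect the limit superior. *)
Definition upper_density (R : realType) (A : set nat) : \bar R :=
  limn_esup (fun n : nat => ((#|` fset_set (A `&` `I_n)|%fset)%:R / n%:R)%:E).

Definition topologically_ergodic (R : realType) (X : metricType R)
    (g : nat -> X -> X) : Prop :=
  forall U V : set X, open U -> open V -> U !=set0 -> V !=set0 ->
    (0 < upper_density R (hitting_times g U V))%E.

Definition autonomous (X : Type) (h : X -> X) : nat -> X -> X := fun=> h.

(* The family h_1, ..., h_k is [h : 'I_k -> X -> X] with h_i = [h (i - 1)]. *)
Definition generated_by (X : Type) (k : nat) (h : 'I_k -> X -> X)
    (f : nat -> X -> X) : Prop :=
  (forall i : 'I_k, f i.+1 = h i) /\
  (forall n : nat, (1 <= n)%N -> f (n + k)%N = f n).

(* Main.v *)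
Require Import Defs.
From mathcomp Require Import all_boot all_order all_algebra.
From mathcomp Require Import all_classical all_reals all_analysis.
From mathcomp Require finmap.

Local Open Scope classical_set_scope.

(** Write g for f_k o ... o f_1. Since f is k-periodic, the first k m maps of
    f compose to the m-th iterate of g, so each hitting time m of (U, V) for g
    gives the hitting time k m for f. The injection m |-> k m sends the
    elements of A below n to elements of B below k n, which costs at most a
    factor k in upper density ([upper_density_le_mul]). Positive upper density
    of the hitting times of g therefore passes to those of f. *)

Lemma iter_seq_addM (X : Type) (k : nat) (f : nat -> X -> X)
    (f_per : forall n, (1 <= n)%N -> f (n + k)%N = f n) (m n : nat) :
  iter_seq f (n + k * m)%N = iter_seq f n \o iter_seq f (k * m)%N.
Proof.
have f_perM p : f (p.+1 + k * m)%N = f p.+1.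
  elim: m => [|m IHm]; first by rewrite muln0 addn0.
  by rewrite mulnS (addnC k) addnA f_per.
by elim: n => [//|n IHn]; rewrite addSn /= IHn -addSn f_perM.
Qed.

Lemma iter_seq_autonomous (X : Type) (k : nat) (f : nat -> X -> X)
    (f_per : forall n, (1 <= n)%N -> f (n + k)%N = f n) (m : nat) :
  iter_seq (autonomous (iter_seq f k)) m = iter_seq f (k * m)%N.
Proof.
elim: m => [|m IHm]; first by rewrite muln0.
by rewrite mulnS iter_seq_addM //= IHm.
Qed.

Lemma leq_card_mul (k : nat) (k_gt0 : (0 < k)%N) (A B : set nat)
    (AB : forall m, A m -> B (k * m)%N) (n : nat) :
  (size (finmap.enum_fset (fset_set (A `&` `I_n)))
     <= size (finmap.enum_fset (fset_set (B `&` `I_(k * n)))))%N.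
Proof.
have fin (C : set nat) p : finite_set (C `&` `I_p).
  exact: sub_finite_set (@subIsetr _ _ _) (finite_II p).
have k_inj : injective (muln k) by move=> i j /eqP; rewrite eqn_pmul2l // => /eqP.
have <- : size (finmap.enum_fset (fset_set (muln k @` (A `&` `I_n)))) =
          size (finmap.enum_fset (fset_set (A `&` `I_n))).
  by rewrite fset_set_image // finmap.card_imfset.
apply: finmap.fsubset_leq_card; rewrite -fset_set_sub //.
  by move=> _ [m [Am ltmn] <-]; split; [exact: AB | rewrite /= ltn_pmul2l].
exact: finite_image.
Qed.

(** The upper density of B is an infimum, over eventual sets W of integers, of
    suprema over W. Each such W is compared with the set of n such that
    k n lies in W, which is again eventual because n <= k n. *)
Lemma upper_density_le_mul (R : realType) (k : nat) (k_gt0 : (0 < k)%N)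
    (A B : set nat) (AB : forall m, A m -> B (k * m)%N) :
  (upper_density R A <= k%:R%:E * upper_density R B)%E.
Proof.
have kR_gt0 : (0 < k%:R :> R)%R by rewrite Num.Theory.ltr0n.
rewrite -lee_pdivrMl // /upper_density /limn_esup !limf_esupE.
apply: le_ereal_inf_tmp => _ [W [N _ NW] <-].
rewrite lee_pdivrMl //; apply: ge_ereal_inf.
exists (ereal_sup [set ((size (finmap.enum_fset
    (fset_set (A `&` `I_n))))%:R / n%:R)%R%:E | n in (muln k) @^-1` W]).
  exists (muln k @^-1` W) => //; exists N => // n /= Nn.
  by apply: NW; rewrite /= (leq_trans Nn) // leq_pmull.
apply: ge_ereal_sup => _ [n Wkn <-].
rewrite -lee_pdivrMl //; apply: le_ereal_sup_tmp.
eexists; first by exists (k * n)%N.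
rewrite -EFinM lee_fin GRing.natrM GRing.invfM GRing.mulrCA.
rewrite Num.Theory.ler_wpM2r -?GRing.invfM -?GRing.natrM ?Num.Theory.invr_ge0
        ?Num.Theory.ler0n //.
by rewrite Num.Theory.ler_nat leq_card_mul.
Qed.

Theorem proposition5p1 (R : realType) (X : metricType R)
    (cptX : compact [set: X]) (k : nat) (k_gt0 : (0 < k)%N)
    (h : 'I_k -> X -> X) (h_cont : forall i : 'I_k, continuous (h i))
    (f : nat -> X -> X) (f_gen : generated_by h f) :
  topologically_ergodic (autonomous (iter_seq f k)) ->
  topologically_ergodic f.
Proof.
move=> g_erg U V oU oV U0 V0; have [_ f_per] := f_gen.
have kR_gt0 : (0 < k%:R%:E :> \bar R)%E by rewrite lte_fin Num.Theory.ltr0n.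
rewrite -(pmule_rgt0 _ kR_gt0).
apply: Order.POrderTheory.lt_le_trans (g_erg U V oU oV U0 V0) _.
apply: upper_density_le_mul => // m.
by rewrite /hitting_times /= iter_seq_autonomous.
Qed.
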